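(* Let $(E,\Lambda)$ be a linear $n$-periodic discrete Lagrangian system, let $V\subset\operatorname{Ker}(P-I)$ be an isotropic subspace of dimension $k$, and assume that the matrices $G_i=(g_i^{\alpha\beta})$, $g_i^{\alpha\beta}=\langle B_iw_i^\alpha,w_{i+1}^\beta\rangle$, are nondegenerate for all $i$. Let $\mathbf{u}=(u_i)$, $u_i\in E_i$, be a trajectory of the system $(E,\Lambda)$ such that $I_i(u_i,u_{i+1})=0$. Then $\mathbf{v}=(v_i)$, $v_i=\Pi_iu_i\in E_i^\perp$, is a trajectory of the linear Lagrangian system $(E^\perp,\Lambda^\perp)$ with the Lagrangian $$\Lambda_i^\perp(v_i,v_{i+1})=\tfrac12\langle A_iv_i,v_i\rangle-\langle B_iv_i,v_{i+1}\rangle-\tfrac12\langle C_iv_i,v_i\rangle,$$ where $$\langle C_iv_i,v_i\rangle=g_{\alpha\beta i}\langle B_iv_i,w_{i+1}^\alpha\rangle\langle B_iv_i,w_{i+1}^\beta\rangle .$$ Conversely, if $\mathbf{v}$ is a trajectory of the system $(E^\perp,\Lambda^\perp)$, then there exists a trajectory $\mathbf{u}$ of the system $(E,\Lambda)$, defined modulo $\Gamma$, such that $I_i(u_i,u_{i+1})=0$ and $\Pi\mathbf{u}=\mathbf{v}$.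
   Context: Summation over repeated Greek indices from $1$ to $k$ is assumed (not over Latin indices). A linear $n$-periodic discrete Lagrangian system $(E,\Lambda)$ consists of $n$-periodic sequences of $m$-dimensional vector spaces $E_i$ and linear operators $A_i:E_i\to E_i^*$ (symmetric), $B_i:E_i\to E_{i+1}^*$ (nondegenerate), $i\in\mathbb{Z}$, with Lagrangian $\Lambda_i(u_i,u_{i+1})=\frac12\langle A_iu_i,u_i\rangle-\langle B_iu_i,u_{i+1}\rangle$. Trajectories are sequences $(u_i)_{i\in\mathbb{Z}}$, $u_i\in E_i$, with $\partial_{u_i}(\Lambda_{i-1}(u_{i-1},u_i)+\Lambda_i(u_i,u_{i+1}))=0$, i.e. $A_iu_i-B_{i-1}u_{i-1}-B_i^*u_{i+1}=0$ for all $i$; the same definition (with derivatives in $E_i^\perp$) is used for $(E^\perp,\Lambda^\perp)$. $W$ is the $2m$-dimensional space of trajectories (identified with pairs $(u_0,u_1)$), $P:W\to W$ is the Poincaré map $(u_0,u_1)\mapsto(u_n,u_{n+1})$, and $\omega(\mathbf{u},\mathbf{v})=\langle B_ju_j,v_{j+1}\rangle-\langle B_jv_j,u_{j+1}\rangle$ (independent of $j$) is the $P$-invariant symplectic form on $W$. $V$ isotropic means $\omega|_V=0$. $\Gamma$ is the set of $n$-periodic trajectories corresponding to $V$; $w^1,\dots,w^k$ is a basis of $V$ and $\mathbf{w}^\alpha=(w_i^\alpha)$ are the corresponding $n$-periodic trajectories. The linear first integrals are $I_j^\alpha(u_j,u_{j+1})=\langle B_jw_j^\alpha,u_{j+1}\rangle-\langle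 B_ju_j,w_{j+1}^\alpha\rangle$, and $I_j=(I_j^1,\dots,I_j^k)$. The matrix $G_i$ is symmetric and $(g_{\alpha\beta i})=G_i^{-1}$. Put $E_i^\perp=\{u\in E_i:\langle B_{i-1}w_{i-1}^\alpha,u\rangle=0,\ \alpha=1,\dots,k\}$, and let $\Pi_i:E_i\to E_i^\perp$ be the projection $\Pi_iu=u-g_{\alpha\beta\,i-1}\langle B_{i-1}w_{i-1}^\alpha,u\rangle w_i^\beta$; $\Pi\mathbf{u}=(\Pi_iu_i)$. *)

(* Defs.v *)
From HB Require Import structures.
From mathcomp Require Import all_boot all_order all_algebra.
From mathcomp Require Import all_classical all_reals all_analysis.
From mathcomp Require Import ring.
From Stdlib Require Import JMeq.

Set Implicit Arguments.
Unset Strict Implicit.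
Unset Printing Implicit Defensive.

Import Order.TTheory GRing.Theory Num.Theory.
Import numFieldNormedType.Exports.

Local Open Scope ring_scope.

(* [u] is critical for the formal action sum: for every i and every direction
   h the partial derivative of L_i(u_i, .) + L_(i+1)(., u_(i+2)) at u_(i+1)
   along h vanishes.  The condition at site i is written at site i + 1, so that
   no transport from E ((i - 1) + 1) to E i is needed. *)
Definition is_trajectory (R : realType) (E : int -> vectType R)
    (L : forall i : int, E i -> E (i + 1) -> R) (u : forall i : int, E i) :=
  forall (i : int) (h : E (i + 1)),
    is_derive (0 : R) (1 : R)
      (fun t : R => L i (u i) (u (i + 1) + t *: h)
                    + L (i + 1) (u (i + 1) + t *: h) (u (i + 1 + 1)))
      (0 : R).

(* The dual space V^* is 'Hom(V, R^o).  Heterogeneous equality expresses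
   periodicity of objects living in the spaces E_(i+n) = E_i. *)
Record linear_dls (R : realType) (n m : nat) := LinearDLS {
  lspace :> int -> vectType R;
  lA : forall i : int, 'Hom(lspace i, 'Hom(lspace i, R^o));
  lB : forall i : int, 'Hom(lspace i, 'Hom(lspace (i + 1), R^o));
  ldim : forall i : int, dim (lspace i) = m;
  lspace_periodic : forall i : int, lspace (i + n%:Z) = lspace i;
  lA_periodic : forall i : int, JMeq (lA (i + n%:Z)) (lA i);
  lB_periodic : forall i : int, JMeq (lB (i + n%:Z)) (lB i);
  lA_sym : forall (i : int) (x y : lspace i), lA i x y = lA i y x;
  lB_nondeg : forall i : int, lker (lB i) == 0%VS
}.

Lemma is_derive_quad (R : realType) (c0 c1 c2 d : R) :
  is_derive (0 : R) (1 : R) (fun t : R => c0 + t * c1 + t ^+ 2 * c2) d <-> c1 = d.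
Proof.
have H : is_derive (0 : R) (1 : R) (fun t : R => c0 + t * c1 + t ^+ 2 * c2) c1.
  have -> : (fun t : R => c0 + t * c1 + t ^+ 2 * c2)
    = (cst c0 + (id * cst c1) + (id ^+ 2 * cst c2)) :> (R -> R) by apply/funext => t /=; rewrite !fctE.
  apply: is_derive_eq; rewrite /= ?fctE /cst /= .
  rewrite /GRing.scale /=; ring.
split=> [Hd|<- //].
by rewrite -(@derive_val _ _ _ _ _ _ _ H) (@derive_val _ _ _ _ _ _ _ Hd).
Qed.

Lemma flip_lfun (R : realType) (X Y : vectType R) (B : 'Hom(X, 'Hom(Y, R^o))) :
  dim X = dim Y -> lker B == 0%VS ->
  exists2 D : 'Hom(Y, 'Hom(X, R^o)), (forall x y, D y x = B x y)
    & exists2 D' : 'Hom('Hom(X, R^o), Y), cancel D D' & cancel D' D.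
Proof.
move=> eqd kB.
have linx y : linear (fun x => B x y : R^o).
  by move=> c x x'; rewrite linearP /= !lfunE /= lfunE.
pose fx y : {linear X -> R^o} := HB.pack (fun x => B x y : R^o) (GRing.isLinear.Build _ _ _ _ _ (linx y)).
have liny : linear (fun y => linfun (fx y)).
  move=> c y y'; apply/lfunP=> x; rewrite add_lfunE scale_lfunE !lfunE /=; exact: linearP.
pose f : {linear Y -> 'Hom(X, R^o)} := HB.pack (fun y => linfun (fx y)) (GRing.isLinear.Build _ _ _ _ _ liny).
have fE x y : linfun f y x = B x y by rewrite !lfunE.
have dimH (Z : vectType R) : \dim {: 'Hom(Z, R^o)} = dim Z.
  by rewrite dimvf /dim /= muln1.
have kD : lker (linfun f) == 0%VS.
  apply/lker0P => y y' eqy; apply/eqP; rewrite -subr_eq0; apply/eqP.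
  set z := y - y'.
  have Bz x : B x z = 0 by rewrite /z linearB /= -!fE eqy subrr.
  have Hz (g : 'Hom(Y, R^o)) : g z = 0.
    have : (limg B == fullv)%VS.
      rewrite eqEdim subvf /= limg_dim_eq; last by rewrite (eqP kB) capv0.
      by rewrite dimH dimvf eqd.
    move/eqP=> lB; have : g \in limg B by rewrite lB memvf.
    by case/memv_imgP => x _ ->.
  rewrite (coord_vbasis (memvf z)) big1 // => i _.
  by have := Hz (linfun (coord (vbasis fullv) i)); rewrite lfunE /= => ->; rewrite scale0r.
exists (linfun f) => //; exists (linfun f)^-1%VF; first exact: lker0_lfunK.
move=> g; rewrite limg_lfunVK //.
suff -> : limg (linfun f) = fullv by rewrite memvf.
apply/eqP; rewrite eqEdim subvf /= limg_dim_eq; last by rewrite (eqP kD) capv0.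
by rewrite dimH dimvf eqd.
Qed.

Section LinearSystem.
Context {R : realType} {n m : nat} (E : linear_dls R n m).

Definition lagrangian (i : int) (x : E i) (y : E (i + 1)) : R :=
  2^-1 * lA E i x x - lB E i x y.

Definition ltrajectory (u : forall i : int, E i) := is_trajectory lagrangian u.

Lemma ltrajectoryE (u : forall i : int, E i) :
  ltrajectory u <->
  forall (i : int) (h : E (i + 1)),
    lA E (i + 1) (u (i + 1)) h - lB E i (u i) h
      - lB E (i + 1) h (u (i + 1 + 1)) = 0 :> R.
Proof.
have H i (h : E (i + 1)) :
  (fun t : R => lagrangian (u i) (u (i + 1) + t *: h)
              + lagrangian (u (i + 1) + t *: h) (u (i + 1 + 1)))
  = (fun t : R => (lagrangian (u i) (u (i + 1)) + lagrangian (u (i + 1)) (u (i + 1 + 1)))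
      + t * (lA E (i + 1) (u (i + 1)) h - lB E i (u i) h
      - lB E (i + 1) h (u (i + 1 + 1))) + t ^+ 2 * (2^-1 * lA E (i + 1) h h)).
  apply/funext => t; rewrite /lagrangian.
  rewrite !(linearD, linearZ) /= !lfunE /= !lfunE /=.
  rewrite !(linearD, linearZ) /= (lA_sym h) /GRing.scale /=.
  by field.
split=> [Hu i h|Hu i h].
  by have := Hu i h; rewrite H => /is_derive_quad.
by rewrite H; apply/is_derive_quad.
Qed.

Definition n_periodic (u : forall i : int, E i) :=
  forall i : int, JMeq (u (i + n%:Z)) (u i).

(* A trajectory is identified with its initial pair (u_0, u_1), so that the
   space of trajectories W is E 0 * E 1. *)
Definition W : vectType R := (E 0 * E 1)%type.

Definition initial (u : forall i : int, E i) : W := (u 0, u 1).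

Definition is_poincare_map (P : 'End(W)) :=
  forall u : forall i : int, E i, ltrajectory u ->
    JMeq (P (initial u)) (u n%:Z, u (n%:Z + 1)).

Lemma lB_solve (i : int) : exists S : 'Hom((E i * E (i + 1)%R)%type, E (i + 1 + 1)),
  forall x y z, (S (x, y) = z) <->
  (forall h : E (i + 1), lA E (i + 1) y h - lB E i x h - lB E (i + 1) h z = 0 :> R).
Proof.
have [|D HD [D' DK D'K]] := flip_lfun _ (lB_nondeg E (i + 1)).
  by rewrite !ldim.
have lin : linear (fun p : (E i * E (i + 1)%R)%type =>
    D' (lA E (i + 1) p.2 - lB E i p.1)).
  move=> c x y; rewrite -linearP; congr (D' _).
  have -> : (c *: x + y).2 = c *: x.2 + y.2 by [].
  have -> : (c *: x + y).1 = c *: x.1 + y.1 by [].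
  rewrite (linearP (lA E (i + 1))) (linearP (lB E i)) opprD addrACA scalerBr; reflexivity.
pose f : {linear (E i * E (i + 1)%R)%type -> E (i + 1 + 1)} :=
  HB.pack (fun p : (E i * E (i + 1)%R)%type => D' (lA E (i + 1) p.2 - lB E i p.1))
    (GRing.isLinear.Build _ _ _ _ _ lin).
exists (linfun f) => x y z; rewrite lfunE /=; split=> [<- h|Hz].
  by rewrite -HD D'K !lfunE /= lfunE /=; ring.
rewrite -[RHS]DK; congr (D' _); apply/lfunP=> h; rewrite HD !lfunE /= lfunE /=.
by apply/eqP; rewrite -subr_eq0; apply/eqP; apply: Hz.
Qed.

Lemma poincare_map_exists : exists P, is_poincare_map P.
Proof.
pose Q (j : int) := exists F : 'Hom(W, (E j * E (j + 1)%R)%type),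
  forall u, ltrajectory u -> F (initial u) = (u j, u (j + 1)).
have Q0 : Q 0 by exists \1%VF => u _; rewrite lfunE.
have QS j : Q j -> Q (j + 1).
  case=> F HF; have [S HS] := lB_solve j.
  have lin : linear (fun x => ((F x).2, S (F x)) : (E (j + 1)%R * E (j + 1 + 1)%R)%type).
    by move=> c x y; rewrite !linearP.
  pose fL := GRing.isLinear.Build _ _ _ _ _ lin.
  pose f : {linear W -> (E (j + 1)%R * E (j + 1 + 1)%R)%type} := HB.pack (fun x => ((F x).2, S (F x)) : (E (j + 1)%R * E (j + 1 + 1)%R)%type) fL.
  exists (linfun f) => u Hu; rewrite lfunE /= HF //=; congr pair.
  by apply/HS; move/ltrajectoryE: Hu => /(_ j).
have: Q n%:Z by elim: n => [//|p IH]; rewrite intS addrC; apply: QS.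
case=> F HF.
have e0 : E n%:Z = E 0 by rewrite -[RHS]lspace_periodic add0r.
have e1 : E (n%:Z + 1) = E 1 by rewrite -[RHS]lspace_periodic addrC.
rewrite /is_poincare_map.
suff [P HP]: exists P : 'End(W), forall x, JMeq (P x) (F x).
  by exists P => u Hu; rewrite -HF.
rewrite /W in F HF *; move: F {HF}.
move: (E n%:Z) (E (n%:Z + 1)) e0 e1 => X Y -> -> F.
by exists F.
Qed.

(* The symplectic form, evaluated at j = 0. *)
Definition omega (x y : W) : R := lB E 0 x.1 y.2 - lB E 0 y.1 x.2.

Definition isotropic (V : {vspace W}) :=
  forall x y : W, x \in V -> y \in V -> omega x y = 0.

Definition Gamma (V : {vspace W}) (u : forall i : int, E i) :=
  [/\ ltrajectory u, n_periodic u & initial u \in V].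

Section Reduction.
Context {k : nat} (w : 'I_k -> forall i : int, E i).

Definition first_integral (a : 'I_k) (j : int) (x : E j) (y : E (j + 1)) : R :=
  lB E j (w a j) y - lB E j x (w a (j + 1)).

Definition Gmx (i : int) : 'M[R]_k :=
  \matrix_(a, b) lB E i (w a i) (w b (i + 1)).

Definition ginv (i : int) (a b : 'I_k) : R := invmx (Gmx i) a b.

(* The covector B_(i-1) w_(i-1)^a, transported along (i - 1) + 1 = i. *)
Definition Bw (i : int) (a : 'I_k) : 'Hom(E i, R^o) :=
  ecast j ('Hom(E j, R^o)) (subrK 1 i) (lB E (i - 1) (w a (i - 1))).

Definition Eperp (i : int) : {vspace E i} :=
  (\bigcap_(a < k) lker (Bw i a))%VS.

Definition Eperp_space (i : int) : vectType R := subvs_of (Eperp i).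

Definition Pi (i : int) (x : E i) : E i :=
  x - \sum_(a < k) \sum_(b < k) (ginv (i - 1) a b * Bw i a x) *: w b i.

Definition Cform (i : int) (x : E i) : R :=
  \sum_(a < k) \sum_(b < k)
    ginv i a b * lB E i x (w a (i + 1)) * lB E i x (w b (i + 1)).

Definition lagrangian_perp (i : int)
    (x : Eperp_space i) (y : Eperp_space (i + 1)) : R :=
  2^-1 * lA E i (vsval x) (vsval x) - lB E i (vsval x) (vsval y)
  - 2^-1 * Cform (vsval x).

End Reduction.
End LinearSystem.

(* Main.v *)
Require Import Defs.
From mathcomp Require Import all_boot all_order all_algebra.
From mathcomp Require Import all_classical all_reals all_analysis.
From mathcomp Require Import ring.
From Stdlib Require Import JMeq.

Import Order.TTheory GRing.Theory Num.Theory.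
Import numFieldNormedType.Exports.

Local Open Scope ring_scope.

Set Implicit Arguments.
Unset Strict Implicit.
Unset Printing Implicit Defensive.

(** Every u_i splits uniquely as u_i = v_i + sum_b lam_i^b w_i^b with
    v_i = Pi_i u_i in E_i^perp, because G_(i-1) is invertible.  In these
    coordinates the first integrals all vanish if and only if lam solves the
    first-order recurrence
      lam_(i+1) - lam_i = drift_i(v),
      drift_i(v)^b = sum_a g_(ab i) <B_i v_i, w_(i+1)^a>
    ([first_integral_eq0], [first_integral_lift]); this uses that G_i is
    symmetric, which follows from isotropy of V and from the invariance of the
    symplectic form ([wronskian_const], [Gmx_isotropic_sym]).

    As the w^b are trajectories, substituting the recurrence into the
    Euler-Lagrange covector of u makes every term containing lam cancel:
      EL(u) h = EL(v) h + sum_b drift_i^b <B_i w_i^b, h>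
                        - sum_b drift_(i+1)^b <B_(i+1) h, w_(i+2)^b>.
    For h in E_(i+1)^perp the second term vanishes and the third one is
    <C_(i+1) v_(i+1), h> ([EL_lift]), so EL(u) vanishes on E^perp exactly when v
    is a trajectory of the reduced system ([perp_trajectoryP]).  On the
    complementary directions w_(i+1)^a the covector EL(u) vanishes
    because the first integrals do ([EL_symmetry], [trajectory_of_perp]).

    For the converse the recurrence is solved for lam over all integers
    ([int_recurrence]).  The difference of two lifts of v is again a trajectory
    with vanishing first integrals, its E^perp-component is zero, and hence its
    lam is constant ([trivial_reduction]).  Such constant combinations of the
    w^b are exactly the elements of Gamma ([GammaP]), where periodicity comes
    from V being fixed by the Poincare map ([fixed_periodic]). *)

(** * Sequences indexed by the integers *)

Lemma int_shift_ind (Q : int -> Prop) :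
  Q 0 -> (forall i, Q i -> Q (i + 1)) -> (forall i, Q (i + 1) -> Q i) ->
  forall i, Q i.
Proof.
move=> Q0 QS QP [p|p].
  by elim: p => // p IH; rewrite intS addrC; apply: QS.
elim: p => [|p IH]; first by apply: QP; rewrite NegzE addNr.
apply: QP; suff -> : Negz p.+1 + 1 = Negz p by [].
by rewrite !NegzE (intS p.+1); ring.
Qed.

(** Facts about site i are proved at site i + 1, where the transport hidden in
    [Bw] disappears. *)
Lemma int_shift_forall (Q : int -> Prop) :
  (forall i, Q (i + 1)) -> forall i, Q i.
Proof. by move=> QS i; rewrite -(subrK 1 i). Qed.

Lemma int_recurrence (I : Type) (R : zmodType) (mu : int -> I -> R) :
  exists lam : int -> I -> R, forall i b, lam (i + 1) b = lam i b + mu i b.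
Proof.
(* Negz p stands for - (p + 1), hence the p + 1 terms. *)
exists (fun i b => match i with
  | Posz p => \sum_(j < p) mu j%:Z b
  | Negz p => - \sum_(j < p.+1) mu (Negz j) b end) => i b.
case: i => [p|[|p]].
- by rewrite addrC -intS big_ord_recr.
- rewrite (_ : Negz 0 + 1 = 0) //=.
  by rewrite big_ord0 big_ord_recl big_ord0 addr0 addNr.
- have -> : Negz p.+1 + 1 = Negz p.
    by rewrite !NegzE (intS p.+1); ring.
  by rewrite [X in _ = - X + _]big_ord_recr /= opprD addrNK.
Qed.

(** * Bilinear forms with values in a dual space *)

Section Bilinear.
Context {R : realType} {X Y : vectType R} (F : 'Hom(X, 'Hom(Y, R^o))).
Implicit Types (x : X) (y : Y).

Lemma bilinDl x x' y : F (x + x') y = F x y + F x' y :> R.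
Proof. by rewrite linearD add_lfunE. Qed.

Lemma bilinBl x x' y : F (x - x') y = F x y - F x' y :> R.
Proof. by rewrite linearB add_lfunE opp_lfunE. Qed.

Lemma bilinZl (c : R) x y : F (c *: x) y = c * F x y :> R.
Proof. by rewrite linearZ scale_lfunE. Qed.

Lemma bilinDr x y y' : F x (y + y') = F x y + F x y' :> R.
Proof. exact: linearD. Qed.

Lemma bilinBr x y y' : F x (y - y') = F x y - F x y' :> R.
Proof. exact: linearB. Qed.

Lemma bilinZr (c : R) x y : F x (c *: y) = c * F x y :> R.
Proof. exact: linearZ. Qed.

Lemma bilin_suml (I : finType) (c : I -> R) (f : I -> X) y :
  F (\sum_b c b *: f b) y = \sum_b c b * F (f b) y :> R.
Proof.
by rewrite linear_sum sum_lfunE; apply: eq_bigr => b _; rewrite bilinZl.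
Qed.

Lemma bilin_sumr (I : finType) (c : I -> R) x (f : I -> Y) :
  F x (\sum_b c b *: f b) = \sum_b c b * F x (f b) :> R.
Proof. by rewrite linear_sum; apply: eq_bigr => b _; exact: bilinZr. Qed.

End Bilinear.

Lemma bilin_nondeg_r (R : realType) (X Y : vectType R)
    (F : 'Hom(X, 'Hom(Y, R^o))) (y : Y) :
  dim X = dim Y -> lker F == 0%VS -> (forall x, F x y = 0) -> y = 0.
Proof.
move=> eqd kF F0; have [D DE [D' DK _]] := flip_lfun eqd kF.
apply: (can_inj DK); rewrite linear0; apply/lfunP => x.
by rewrite DE F0 zero_lfunE.
Qed.

Lemma bilin_nondeg_l (R : realType) (X Y : vectType R)
    (F : 'Hom(X, 'Hom(Y, R^o))) (x : X) :
  lker F == 0%VS -> (forall y, F x y = 0) -> x = 0.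
Proof.
move=> /lker0P Finj F0; apply: Finj; rewrite linear0; apply/lfunP => y.
by rewrite F0 zero_lfunE.
Qed.

(** * Heterogeneous equality along equal spaces *)

Lemma JMeq_bilin (R : realType) (X X' Y Y' : vectType R)
    (F : 'Hom(X, 'Hom(Y, R^o))) (F' : 'Hom(X', 'Hom(Y', R^o)))
    (x : X) (x' : X') (y : Y) (y' : Y') :
  X = X' -> Y = Y' -> JMeq F F' -> JMeq x x' -> JMeq y y' ->
  F x y = F' x' y' :> R.
Proof.
move=> eX eY; move: F' x' y'; rewrite -eX -eY => F' x' y'.
by move=> hF hx hy; rewrite (JMeq_eq hF) (JMeq_eq hx) (JMeq_eq hy).
Qed.

Lemma JMeq_pair (X X' Y Y' : Type) (x : X) (x' : X') (y : Y) (y' : Y') :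
  X = X' -> Y = Y' -> JMeq (x, y) (x', y') -> JMeq x x' /\ JMeq y y'.
Proof.
move=> eX eY; move: x' y'; rewrite -eX -eY => x' y' h.
by case: (JMeq_eq h) => -> ->.
Qed.

Lemma JMeq_index (R : realType) (E : int -> vectType R) (u : forall i, E i)
    (i j : int) : i = j -> JMeq (u i) (u j).
Proof. by move->. Qed.

Lemma JMeq_lincomb (R : realType) (X X' : vectType R) (I : finType) (c : I -> R)
    (f : I -> X) (f' : I -> X') :
  X = X' -> (forall b, JMeq (f b) (f' b)) ->
  JMeq (\sum_b c b *: f b) (\sum_b c b *: f' b).
Proof.
move=> eX; move: f'; rewrite -eX => f' ff'.
rewrite (eq_bigr (fun b => c b *: f' b)) // => b _.
by rewrite (JMeq_eq (ff' b)).
Qed.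

(** * Trajectories of a linear system *)

Section Trajectories.
Context {R : realType} {n m : nat} (E : linear_dls R n m).
Implicit Types (u v : forall i : int, E i).

(** The Euler-Lagrange covector of u at site i + 1, evaluated at h. *)
Definition EL u (i : int) (h : E (i + 1)) : R :=
  lA E (i + 1) (u (i + 1)) h - lB E i (u i) h - lB E (i + 1) h (u (i + 1 + 1)).

Lemma ltrajectoryP u :
  ltrajectory u <-> forall (i : int) (h : E (i + 1)), EL u h = 0.
Proof. exact: ltrajectoryE. Qed.

Lemma ELB u v (i : int) (h : E (i + 1)) :
  EL (fun j => u j - v j) h = EL u h - EL v h.
Proof. by rewrite /EL !bilinBl bilinBr; ring. Qed.

Lemma EL_lincomb (I : finType) (c : I -> R) (w : I -> forall i, E i) (i : int)
    (h : E (i + 1)) :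
  EL (fun j => \sum_b c b *: w b j) h = \sum_b c b * EL (w b) h.
Proof.
rewrite /EL !bilin_suml bilin_sumr -!sumrB; apply: eq_bigr => b _; ring.
Qed.

Lemma ltrajectoryB u v :
  ltrajectory u -> ltrajectory v -> ltrajectory (fun i => u i - v i).
Proof.
move=> /ltrajectoryP hu /ltrajectoryP hv; apply/ltrajectoryP => i h.
by rewrite ELB hu hv subrr.
Qed.

Lemma ltrajectory_lincomb (I : finType) (c : I -> R) (w : I -> forall i, E i) :
  (forall b, ltrajectory (w b)) -> ltrajectory (fun j => \sum_b c b *: w b j).
Proof.
move=> hw; apply/ltrajectoryP => i h; rewrite EL_lincomb big1 // => b _.
by have /ltrajectoryP-> := hw b; rewrite mulr0.
Qed.

(** A trajectory is determined, in both time directions, by (u_0, u_1). *)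
Lemma trajectory_eq0 u : ltrajectory u -> initial u = 0 -> forall i, u i = 0.
Proof.
move=> /ltrajectoryP hu [u0 u1] i.
suff: u i = 0 /\ u (i + 1) = 0 by case.
elim/int_shift_ind: i => [//|i [ui ui1]|i [ui1 ui2]]; split=> //.
- apply: (bilin_nondeg_r _ (lB_nondeg E (i + 1))) => [|h].
    by rewrite !ldim.
  have := hu i h; rewrite /EL ui ui1 !linear0 !zero_lfunE subrr sub0r.
  by move/eqP; rewrite oppr_eq0 => /eqP.
- apply: (bilin_nondeg_l (lB_nondeg E i)) => h.
  have := hu i h; rewrite /EL ui1 ui2 !linear0 !zero_lfunE sub0r addr0.
  by move/eqP; rewrite oppr_eq0 => /eqP.
Qed.

Lemma trajectory_eq u v : ltrajectory u -> ltrajectory v ->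
  initial u = initial v -> forall i, u i = v i.
Proof.
move=> hu hv [e0 e1] i; apply/eqP; rewrite -subr_eq0; apply/eqP; move: i.
apply: trajectory_eq0; first exact: ltrajectoryB.
by rewrite /initial e0 e1 !subrr.
Qed.

(** The symplectic form may be computed at any site. *)
Lemma wronskian_const u v : ltrajectory u -> ltrajectory v -> forall i,
  lB E i (u i) (v (i + 1)) - lB E i (v i) (u (i + 1))
  = omega (initial u) (initial v).
Proof.
move=> /ltrajectoryP hu /ltrajectoryP hv.
have step i : lB E i (u i) (v (i + 1)) - lB E i (v i) (u (i + 1))
  = lB E (i + 1) (u (i + 1)) (v (i + 1 + 1))
    - lB E (i + 1) (v (i + 1)) (u (i + 1 + 1)) :> R.
  have := hu i (v (i + 1)); have := hv i (u (i + 1)).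
  rewrite /EL (lA_sym (v (i + 1))) => e1 e2.
  apply/eqP; rewrite -subr_eq0; apply/eqP.
  rewrite -[RHS](subrr (0 : R)) -{1}e1 -e2; ring.
by move=> i; elim/int_shift_ind: i => [//|i|i]; rewrite (step i).
Qed.

(** The sequence i |-> u_(i+n), brought back to the spaces E_i = E_(i+n). *)
Definition shift u (i : int) : E i :=
  ecast X (X : vectType R) (lspace_periodic E i) (u (i + n%:Z)).

Lemma shiftE u i : JMeq (shift u i) (u (i + n%:Z)).
Proof. by rewrite /shift; case: _ / (lspace_periodic E i). Qed.

Lemma ltrajectory_shift u : ltrajectory u -> ltrajectory (shift u).
Proof.
move=> /ltrajectoryP hu; apply/ltrajectoryP => i h.
have eS j : j + 1 + n%:Z = j + n%:Z + 1 by rewrite addrAC.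
have eX j : lspace E (j + n%:Z + 1) = lspace E (j + 1).
  by rewrite -eS lspace_periodic.
have s1 j : JMeq (shift u (j + 1)) (u (j + n%:Z + 1)).
  by apply: JMeq_trans (shiftE u (j + 1)) _; apply: (JMeq_index u).
have s2 : JMeq (shift u (i + 1 + 1)) (u (i + n%:Z + 1 + 1)).
  by apply: JMeq_trans (s1 (i + 1)) _; apply: (JMeq_index u); rewrite eS.
have [h' hh'] : exists h' : E (i + n%:Z + 1), JMeq h h'.
  by rewrite eX; exists h.
have hA : JMeq (lA E (i + 1)) (lA E (i + n%:Z + 1)).
  apply: JMeq_sym; apply: JMeq_trans (lA_periodic E (i + 1)).
  by rewrite eS.
have hB : JMeq (lB E i) (lB E (i + n%:Z)) by exact: JMeq_sym (lB_periodic E i).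
have hB1 : JMeq (lB E (i + 1)) (lB E (i + n%:Z + 1)).
  apply: JMeq_sym; apply: JMeq_trans (lB_periodic E (i + 1)).
  by rewrite eS.
have e2 : lspace E (i + n%:Z + 1 + 1) = lspace E (i + 1 + 1).
  by rewrite -!eS lspace_periodic.
rewrite -(hu _ h') /EL.
rewrite (JMeq_bilin _ _ hA (s1 i) hh') //.
rewrite (JMeq_bilin _ _ hB (shiftE u i) hh') ?lspace_periodic //.
by rewrite (JMeq_bilin _ _ hB1 hh' s2).
Qed.

(** The shifted sequence is a trajectory with the same initial pair, hence
    equal to u. *)
Lemma fixed_periodic (P : 'End(W E)) u : is_poincare_map P -> ltrajectory u ->
  P (initial u) = initial u -> n_periodic u.
Proof.
move=> hP hu fixu.
have e0 : lspace E n%:Z = E 0 by rewrite -[RHS]lspace_periodic add0r.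
have e1 : lspace E (n%:Z + 1) = E 1 by rewrite -[RHS]lspace_periodic addrC.
have hp := hP u hu; rewrite fixu in hp.
have [h0 h1] : JMeq (u 0) (u n%:Z) /\ JMeq (u 1) (u (n%:Z + 1)).
  by apply: JMeq_pair hp; rewrite ?e0 ?e1.
have e i : shift u i = u i.
  apply: trajectory_eq => //; first exact: ltrajectory_shift.
  congr pair; apply: JMeq_eq; apply: JMeq_trans (shiftE u _) _.
    apply: JMeq_sym; apply: JMeq_trans h0 _.
    by apply: (JMeq_index u); rewrite add0r.
  apply: JMeq_sym; apply: JMeq_trans h1 _.
  by apply: (JMeq_index u); rewrite addrC.
by move=> i; apply: JMeq_sym; rewrite -(e i); apply: shiftE.
Qed.

End Trajectories.

(** * The splitting of E_i into E_i^perp and the span of the w_i^b *)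

Section ReductionTheory.
Context {R : realType} {n m k : nat} (E : linear_dls R n m).
Context (w : 'I_k -> forall i : int, E i).
Context (w_trajectory : forall a, ltrajectory (w a)).
Context (G_unit : forall i, Gmx w i \in unitmx).
Context (G_sym : forall i, (Gmx w i)^T = Gmx w i).
Implicit Types (u v : forall i : int, E i) (lam mu : int -> 'I_k -> R).

(** At site i + 1 the transported covector [Bw] is B_i w_i^a itself. *)
Lemma Bw_succ (i : int) (a : 'I_k) : Bw w (i + 1) a = lB E i (w a i).
Proof.
rewrite /Bw; move: (subrK 1 (i + 1)).
have := addrK 1 i; move: (i + 1 - 1) => j ej; subst j => e.
by rewrite (eq_axiomK e).
Qed.

Lemma EperpP (i : int) (x : E (i + 1)) :
  reflect (forall a, lB E i (w a i) x = 0) (x \in Eperp w (i + 1)).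
Proof.
rewrite memvE; apply: (iffP subv_bigcapP) => h a.
  by have := h a isT; rewrite -memvE memv_ker Bw_succ => /eqP.
by move=> _; rewrite -memvE memv_ker Bw_succ; apply/eqP.
Qed.

(** The solution of the linear system with matrix G_i and right-hand side f,
    provided that G_i is invertible and symmetric. *)
Definition Gsolve (i : int) (f : 'I_k -> R) (b : 'I_k) : R :=
  \sum_(a < k) ginv w i a b * f a.

Lemma sum_ginv_Gmx (i : int) (a c : 'I_k) :
  \sum_(b < k) ginv w i a b * Gmx w i b c = (a == c)%:R.
Proof.
have /matrixP/(_ a c) := mulVmx (G_unit i).
by rewrite [in RHS]mxE mxE => <-.
Qed.

Lemma sum_Gmx_ginv (i : int) (a c : 'I_k) :
  \sum_(b < k) Gmx w i a b * ginv w i b c = (a == c)%:R.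
Proof.
have /matrixP/(_ a c) := mulmxV (G_unit i).
by rewrite [in RHS]mxE mxE => <-.
Qed.

Lemma Gmx_sym (i : int) (a b : 'I_k) : Gmx w i a b = Gmx w i b a.
Proof. by rewrite -[in LHS]G_sym mxE. Qed.

Lemma ginv_sym (i : int) (a b : 'I_k) : ginv w i a b = ginv w i b a.
Proof. by rewrite /ginv -{1}[Gmx w i]G_sym -trmx_inv mxE. Qed.

Lemma sum_mul_delta (c : 'I_k) (f : 'I_k -> R) :
  \sum_(a < k) f a * (a == c)%:R = f c.
Proof.
rewrite (bigD1 c) //= eqxx mulr1 big1 ?addr0 // => a /negbTE->.
by rewrite mulr0.
Qed.

Lemma GsolveK (i : int) (f : 'I_k -> R) (c : 'I_k) :
  \sum_(b < k) Gsolve i f b * Gmx w i c b = f c.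
Proof.
rewrite -[RHS]sum_mul_delta.
under [RHS]eq_bigr do rewrite -(sum_ginv_Gmx i) mulr_sumr.
rewrite exchange_big; apply: eq_bigr => b _.
rewrite /Gsolve mulr_suml; apply: eq_bigr => a _.
by rewrite (Gmx_sym i c) -mulrA mulrCA.
Qed.

Lemma Gsolve_unique (i : int) (f g : 'I_k -> R) :
  (forall c, \sum_(b < k) g b * Gmx w i c b = f c) -> Gsolve i f =1 g.
Proof.
move=> hg b; rewrite -[RHS]sum_mul_delta.
under [RHS]eq_bigr do rewrite -(sum_Gmx_ginv i) mulr_sumr.
rewrite exchange_big; apply: eq_bigr => a _.
rewrite -hg mulr_sumr; apply: eq_bigr => c _.
by rewrite (Gmx_sym i a); ring.
Qed.

(** The coordinates of x on the w_i^b, transversally to E_i^perp. *)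
Definition coef (i : int) (x : E i) (b : 'I_k) : R :=
  \sum_(a < k) ginv w (i - 1) a b * Bw w i a x.

Lemma PiE (i : int) (x : E i) : Pi w x = x - \sum_(b < k) coef x b *: w b i.
Proof.
rewrite /Pi exchange_big /=; congr (_ - _).
by apply: eq_bigr => b _; rewrite -scaler_suml.
Qed.

Lemma coef_succ (i : int) (x : E (i + 1)) :
  coef x =1 Gsolve i (fun a => lB E i (w a i) x).
Proof.
by move=> b; rewrite /coef addrK; apply: eq_bigr => a _; rewrite Bw_succ.
Qed.

Lemma lB_w_lincomb (i : int) (c : 'I_k -> R) (a : 'I_k) :
  lB E i (w a i) (\sum_(b < k) c b *: w b (i + 1))
  = \sum_(b < k) c b * Gmx w i a b :> R.
Proof. by rewrite bilin_sumr; apply: eq_bigr => b _; rewrite mxE. Qed.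

Lemma Pi_Eperp (i : int) (x : E i) : Pi w x \in Eperp w i.
Proof.
elim/int_shift_forall: i x => i x; apply/EperpP => a.
rewrite PiE bilinBr lB_w_lincomb.
rewrite (eq_bigr (fun b =>
  Gsolve i (fun a => lB E i (w a i) x) b * Gmx w i a b)).
  by rewrite GsolveK subrr.
by move=> b _; rewrite coef_succ.
Qed.

Lemma Pi_add_lincomb (i : int) (x : E i) (c : 'I_k -> R) :
  x \in Eperp w i -> Pi w (x + \sum_(b < k) c b *: w b i) = x.
Proof.
elim/int_shift_forall: i x => i x /EperpP hx.
rewrite PiE -[RHS](addrK (\sum_(b < k) c b *: w b (i + 1))).
congr (_ - _); apply: eq_bigr => b _.
rewrite coef_succ; congr (_ *: _); apply: Gsolve_unique => a.
by rewrite bilinDr hx add0r lB_w_lincomb.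
Qed.

(** * First integrals and the recurrence for the coordinates *)

Lemma first_integral_split (i : int) (x : E i) (y : E (i + 1))
    (c d : 'I_k -> R) (a : 'I_k) : y \in Eperp w (i + 1) ->
  first_integral w a (x + \sum_(b < k) c b *: w b i)
                     (y + \sum_(b < k) d b *: w b (i + 1))
  = \sum_(b < k) (d b - c b) * Gmx w i a b - lB E i x (w a (i + 1)).
Proof.
move=> /EperpP hy; rewrite /first_integral bilinDr hy add0r lB_w_lincomb.
rewrite bilinDl bilin_suml opprD addrA addrAC -sumrB; congr (_ - _).
apply: eq_bigr => b _; rewrite mulrBl; congr (_ - _ * _).
by rewrite -[in RHS]G_sym !mxE.
Qed.

Lemma first_integral_eq0 (i : int) (x : E i) (y : E (i + 1))
    (c d : 'I_k -> R) : y \in Eperp w (i + 1) ->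
  (forall a, first_integral w a (x + \sum_(b < k) c b *: w b i)
                     (y + \sum_(b < k) d b *: w b (i + 1)) = 0)
  <-> (forall b, d b = c b + Gsolve i (fun a => lB E i x (w a (i + 1))) b).
Proof.
move=> hy; split=> [h b|h a].
  rewrite (@Gsolve_unique i _ (fun b => d b - c b)) ?subrKC // => a.
  by apply/eqP; rewrite -subr_eq0 -(first_integral_split _ _ _ a hy) h.
rewrite first_integral_split //.
rewrite (eq_bigr (fun b =>
  Gsolve i (fun a => lB E i x (w a (i + 1))) b * Gmx w i a b)).
  by rewrite GsolveK subrr.
by move=> b _; rewrite h addrAC subrr add0r.
Qed.

(** * The Lagrangian of the reduced system *)

(** The symmetric bilinear form whose quadratic form is [Cform]. *)
Definition Cpolar (i : int) (x y : E i) : R :=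
  \sum_(b < k) Gsolve i (fun a => lB E i x (w a (i + 1))) b
               * lB E i y (w b (i + 1)).

Lemma CformE (i : int) (x : E i) : Cform w x = Cpolar x x.
Proof.
rewrite /Cform /Cpolar exchange_big; apply: eq_bigr => b _.
by rewrite mulr_suml.
Qed.

Lemma Cpolar_sym (i : int) (x y : E i) : Cpolar x y = Cpolar y x.
Proof.
rewrite /Cpolar /Gsolve.
under eq_bigr do rewrite mulr_suml.
under [RHS]eq_bigr do rewrite mulr_suml.
rewrite exchange_big; apply: eq_bigr => a _; apply: eq_bigr => b _.
rewrite ginv_sym; ring.
Qed.

Lemma CpolarDr (i : int) (x y y' : E i) :
  Cpolar x (y + y') = Cpolar x y + Cpolar x y'.
Proof.
by rewrite /Cpolar -big_split; apply: eq_bigr => b _; rewrite bilinDl mulrDr.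
Qed.

Lemma CpolarZr (c : R) (i : int) (x y : E i) :
  Cpolar x (c *: y) = c * Cpolar x y.
Proof.
by rewrite /Cpolar mulr_sumr; apply: eq_bigr => b _; rewrite bilinZl mulrCA.
Qed.

Lemma Cform_line (i : int) (x h : E i) (t : R) :
  Cform w (x + t *: h) = Cform w x + t * (2 * Cpolar x h) + t ^+ 2 * Cform w h.
Proof.
rewrite !CformE CpolarDr CpolarZr !(Cpolar_sym (x + t *: h)).
rewrite !CpolarDr !CpolarZr.
rewrite (Cpolar_sym h x); ring.
Qed.

(** The Euler-Lagrange equation of the reduced system. *)
Lemma perp_trajectoryP (v : forall i : int, Eperp_space w i) :
  is_trajectory (@lagrangian_perp R n m E k w) v <->
  forall (i : int) (h : E (i + 1)), h \in Eperp w (i + 1) ->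
    EL (fun j => vsval (v j)) h = Cpolar (vsval (v (i + 1))) h.
Proof.
have H i (h : Eperp_space w (i + 1)) :
  (fun t : R => lagrangian_perp (v i) (v (i + 1) + t *: h)
              + lagrangian_perp (v (i + 1) + t *: h) (v (i + 1 + 1)))
  = (fun t : R => (lagrangian_perp (v i) (v (i + 1))
                   + lagrangian_perp (v (i + 1)) (v (i + 1 + 1)))
      + t * (EL (fun j => vsval (v j)) (vsval h)
             - Cpolar (vsval (v (i + 1))) (vsval h))
      + t ^+ 2 * (2^-1 * lA E (i + 1) (vsval h) (vsval h)
                  - 2^-1 * Cform w (vsval h))).
  apply/funext => t.
  have eh : vsval (v (i + 1) + t *: h) = vsval (v (i + 1)) + t *: vsval h.
    by rewrite linearD linearZ.
  rewrite /lagrangian_perp eh Cform_line /EL.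
  rewrite !(bilinDl, bilinDr, bilinZl, bilinZr) (lA_sym (vsval h)).
  by field.
split=> [hv i h hh|hv i h].
  have := hv i (Subvs hh); rewrite H => /is_derive_quad /eqP.
  by rewrite subr_eq0 => /eqP.
by rewrite H; apply/is_derive_quad; rewrite hv ?subrr //; apply: subvsP.
Qed.

(** * Lifting from the reduced system *)

Lemma EL_split v lam mu (i : int) (h : E (i + 1)) :
  (forall (i : int) b, lam (i + 1) b = lam i b + mu i b) ->
  EL (fun j => v j + \sum_(b < k) lam j b *: w b j) h
  = EL v h + \sum_(b < k) mu i b * lB E i (w b i) h
    - \sum_(b < k) mu (i + 1) b * lB E (i + 1) h (w b (i + 1 + 1)).
Proof.
move=> rec; apply/eqP; rewrite -subr_eq0; apply/eqP.
(* The recurrence moves all coefficients to site i + 1; what remains is a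
   combination of the Euler-Lagrange covectors of the w^b. *)
rewrite [LHS](_ : _ = \sum_(b < k) lam (i + 1) b * EL (w b) h).
  rewrite big1 // => b _.
  by have /ltrajectoryP-> := w_trajectory b; rewrite mulr0.
rewrite /EL !bilinDl bilinDr !bilin_suml bilin_sumr.
under [RHS]eq_bigr do rewrite !mulrBr.
rewrite !sumrB.
have -> : \sum_b lam (i + 1) b * lB E i (w b i) h
  = \sum_b lam i b * lB E i (w b i) h + \sum_b mu i b * lB E i (w b i) h :> R.
  by rewrite -big_split; apply: eq_bigr => b _; rewrite rec mulrDl.
have -> : \sum_b lam (i + 1 + 1) b * lB E (i + 1) h (w b (i + 1 + 1))
  = \sum_b lam (i + 1) b * lB E (i + 1) h (w b (i + 1 + 1))
    + \sum_b mu (i + 1) b * lB E (i + 1) h (w b (i + 1 + 1)) :> R.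
  by rewrite -big_split; apply: eq_bigr => b _; rewrite rec mulrDl.
ring.
Qed.

(** The increment of the coordinates on w dictated by vanishing first
    integrals. *)
Definition drift v (i : int) (b : 'I_k) : R :=
  Gsolve i (fun a => lB E i (v i) (w a (i + 1))) b.

(** The sequence with E^perp-component v and coordinates lam on w. *)
Definition lift_by v lam (i : int) : E i := v i + \sum_(b < k) lam i b *: w b i.

(** On E_(i+1)^perp the Euler-Lagrange covector of a lift of v is that of v in
    the reduced system; the coordinates lam no longer appear. *)
Lemma EL_lift v lam (i : int) (h : E (i + 1)) :
  (forall (i : int) b, lam (i + 1) b = lam i b + drift v i b) ->
  h \in Eperp w (i + 1) ->
  EL (lift_by v lam) h = EL v h - Cpolar (v (i + 1)) h.
Proof.
move=> rec /EperpP hh; rewrite (EL_split v h rec) [X in _ + X - _]big1.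
  by rewrite addr0.
by move=> b _; rewrite hh mulr0.
Qed.

Lemma first_integral_lift v lam : (forall i, v i \in Eperp w i) ->
  (forall a i, first_integral w a (lift_by v lam i) (lift_by v lam (i + 1)) = 0)
  <-> (forall (i : int) b, lam (i + 1) b = lam i b + drift v i b).
Proof.
move=> hv; split=> [h i|h a i].
  by apply/(first_integral_eq0 _ _ _ (hv (i + 1))) => a; apply: h.
by move: a; apply/(first_integral_eq0 _ _ _ (hv (i + 1))); apply: h.
Qed.

Lemma lift_by_Pi u : lift_by (fun i => Pi w (u i)) (fun i => coef (u i)) = u.
Proof.
by apply: functional_extensionality_dep => i; rewrite /lift_by PiE subrK.
Qed.

(** Each w^a is an infinitesimal symmetry: along a sequence with vanishing
    first integrals, EL(u) w_(i+1)^a equals EL(w^a) u_(i+1), which is zero. *)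
Lemma EL_symmetry (a : 'I_k) u (i : int) :
  (forall i, first_integral w a (u i) (u (i + 1)) = 0) ->
  EL u (w a (i + 1)) = 0.
Proof.
move=> I0; have /ltrajectoryP/(_ i (u (i + 1))) := w_trajectory a.
move: (I0 i) (I0 (i + 1)); rewrite /first_integral /EL.
by rewrite (lA_sym (w a (i + 1))) => /subr0_eq-> /subr0_eq->.
Qed.

Lemma ELD_dir u (i : int) (h h' : E (i + 1)) : EL u (h + h') = EL u h + EL u h'.
Proof. rewrite /EL !bilinDr bilinDl; ring. Qed.

Lemma EL_lincomb_dir u (i : int) (c : 'I_k -> R) (h : 'I_k -> E (i + 1)) :
  EL u (\sum_b c b *: h b) = \sum_b c b * EL u (h b).
Proof.
rewrite /EL !bilin_sumr bilin_suml -!sumrB; apply: eq_bigr => b _; ring.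
Qed.

Lemma trajectory_of_perp u :
  (forall a i, first_integral w a (u i) (u (i + 1)) = 0) ->
  (forall (i : int) (h : E (i + 1)), h \in Eperp w (i + 1) -> EL u h = 0) ->
  ltrajectory u.
Proof.
move=> I0 hu; apply/ltrajectoryP => i h.
rewrite -[h](subrK (\sum_(b < k) coef h b *: w b (i + 1))) -PiE ELD_dir.
rewrite hu ?Pi_Eperp // EL_lincomb_dir add0r big1 // => b _.
by rewrite EL_symmetry ?mulr0.
Qed.

Lemma PiB (i : int) (x y : E i) : Pi w (x - y) = Pi w x - Pi w y.
Proof.
have coefB b : coef (x - y) b = coef x b - coef y b.
  by rewrite /coef -sumrB; apply: eq_bigr => a _; rewrite linearB mulrBr.
rewrite !PiE (eq_bigr (fun b => coef x b *: w b i - coef y b *: w b i)).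
  by rewrite sumrB !opprD !opprK addrACA.
by move=> b _; rewrite coefB scalerBl.
Qed.

Lemma first_integralB (a : 'I_k) (i : int) (x x' : E i) (y y' : E (i + 1)) :
  first_integral w a (x - x') (y - y')
  = first_integral w a x y - first_integral w a x' y'.
Proof. rewrite /first_integral bilinBr bilinBl; ring. Qed.

(** The trajectories with vanishing first integrals that project to zero are
    the constant combinations of the w^b. *)
Lemma trivial_reduction d :
  [/\ ltrajectory d,
      forall a i, first_integral w a (d i) (d (i + 1)) = 0
    & forall i, Pi w (d i) = 0]
  <-> exists c : 'I_k -> R, d = fun i => \sum_(b < k) c b *: w b i.
Proof.
pose z (i : int) : E i := 0.
have z_perp i : z i \in Eperp w i by exact: mem0v.
have drift0 i b : drift z i b = 0.
  by rewrite /drift /Gsolve big1 // => a _; rewrite /z linear0 zero_lfunE mulr0.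
split=> [[hd Id Pid]|[c ->]].
  have dE : d = lift_by z (fun i => coef (d i)).
    rewrite -[LHS]lift_by_Pi; congr lift_by.
    by apply: functional_extensionality_dep => i; rewrite Pid.
  rewrite dE in Id.
  have /(first_integral_lift _ z_perp) rec := Id.
  exists (coef (d 0)); apply: functional_extensionality_dep => i.
  rewrite [LHS](congr1 (fun f => f i) dE) /lift_by add0r.
  apply: eq_bigr => b _; congr (_ *: _).
  elim/int_shift_ind: i => [//|i|i]; by rewrite rec drift0 addr0.
have cE i : \sum_(b < k) c b *: w b i = lift_by z (fun=> c) i.
  by rewrite /lift_by add0r.
split=> [|a i|i]; first exact: ltrajectory_lincomb.
- rewrite !cE; move: a i; apply/(first_integral_lift (fun=> c) z_perp) => i b.
  by rewrite drift0 addr0.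
- by rewrite cE; apply: Pi_add_lincomb.
Qed.

End ReductionTheory.

(** * Consequences of V being isotropic and fixed by the Poincare map *)

Section SymmetrySpace.
Context {R : realType} {n m k : nat} (E : linear_dls R n m).
Context (V : {vspace W E}) (w : 'I_k -> forall i : int, E i).
Context (w_trajectory : forall a, ltrajectory (w a)).
Context (w_basis : basis_of V [tuple initial (w a) | a < k]).

Lemma initial_w_mem a : initial (w a) \in V.
Proof.
apply: (basis_mem w_basis).
rewrite -[initial (w a)](tnth_mktuple (fun a => initial (w a))).
exact: mem_tnth.
Qed.

Lemma Gmx_isotropic_sym : isotropic V -> forall i, (Gmx w i)^T = Gmx w i.
Proof.
move=> V0 i; apply/matrixP => a b; rewrite !mxE; apply/eqP.
rewrite -subr_eq0 (wronskian_const (w_trajectory b) (w_trajectory a)).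
by rewrite V0 ?initial_w_mem.
Qed.

Lemma initial_lincomb (c : 'I_k -> R) :
  initial (fun i => \sum_(b < k) c b *: w b i)
  = \sum_(b < k) c b *: initial (w b).
Proof.
rewrite [RHS]surjective_pairing; congr pair.
  by rewrite (big_morph (fun p : W E => p.1) (id1 := 0) (op1 := +%R)).
by rewrite (big_morph (fun p : W E => p.2) (id1 := 0) (op1 := +%R)).
Qed.

(** Gamma consists of the constant combinations of the w^b. *)
Lemma GammaP (P : 'End(W E)) (d : forall i, E i) :
  is_poincare_map P -> (V <= lker (P - \1%VF))%VS ->
  Gamma V d <-> exists c : 'I_k -> R, d = fun i => \sum_(b < k) c b *: w b i.
Proof.
move=> hP fixV; split=> [[hd _ dV]|[c ->]].
  pose c b := coord [tuple initial (w a) | a < k] b (initial d).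
  exists c; apply: functional_extensionality_dep => i; move: i.
  apply: trajectory_eq hd (ltrajectory_lincomb c w_trajectory) _.
  rewrite initial_lincomb {1}(coord_basis w_basis dV); apply: eq_bigr => b _.
  by rewrite -tnth_nth tnth_mktuple.
split; first exact: ltrajectory_lincomb.
- move=> i; apply: JMeq_lincomb => [|b]; first exact: lspace_periodic.
  move: i; apply: (fixed_periodic hP) => //.
  have := subvP fixV _ (initial_w_mem b); rewrite memv_ker.
  by rewrite add_lfunE opp_lfunE id_lfunE subr_eq0 => /eqP.
- rewrite initial_lincomb; apply: memv_suml => b _.
  by apply: memvZ; apply: initial_w_mem.
Qed.

End SymmetrySpace.

(** * The reduction theorem *)

Theorem theorem3p1 (R : realType) (n m k : nat) (n_gt0 : (0 < n)%N)
    (E : linear_dls R n m)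
    (P : 'End(W E)) (P_poincare : is_poincare_map P)
    (V : {vspace W E}) (dimV : \dim V = k)
    (V_fixed : (V <= lker (P - \1%VF))%VS)
    (V_isotropic : isotropic V)
    (w : 'I_k -> forall i : int, E i)
    (w_trajectory : forall a : 'I_k, ltrajectory (w a))
    (w_basis : basis_of V [tuple initial (w a) | a < k])
    (G_nondeg : forall i : int, Gmx w i \in unitmx) :
  (forall u : forall i : int, E i,
      ltrajectory u ->
      (forall (a : 'I_k) (i : int), first_integral w a (u i) (u (i + 1)) = 0) ->
      exists v : forall i : int, Eperp_space w i,
        (forall i : int, vsval (v i) = Pi w (u i))
        /\ is_trajectory (@lagrangian_perp R n m E k w) v)
  /\
  (forall v : forall i : int, Eperp_space w i,
      is_trajectory (@lagrangian_perp R n m E k w) v ->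
      let lifts (u : forall i : int, E i) :=
        [/\ ltrajectory u,
            forall (a : 'I_k) (i : int),
              first_integral w a (u i) (u (i + 1)) = 0
          & forall i : int, Pi w (u i) = vsval (v i)] in
      exists u : forall i : int, E i,
        lifts u
        /\ forall u' : forall i : int, E i,
             lifts u' <-> Gamma V (fun i : int => u' i - u i)).
Proof.
have G_sym := Gmx_isotropic_sym w_trajectory w_basis V_isotropic.
have Pi_perp i (x : E i) : Pi w x \in Eperp w i by exact: Pi_Eperp.
split=> [u u_traj Iu|v v_traj lifts].
  pose v i : Eperp_space w i := Subvs (Pi_perp i (u i)).
  exists v; split; first by [].
  apply/(perp_trajectoryP G_sym) => i h h_perp.
  rewrite -(lift_by_Pi w u) in Iu u_traj.
  have rec := iffLR (first_integral_lift G_nondeg G_sym _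
    (fun i => Pi_perp i (u i))) Iu.
  have /ltrajectoryP/(_ i h) := u_traj.
  rewrite (EL_lift w_trajectory rec h_perp) => /eqP.
  by rewrite subr_eq0 => /eqP.
pose v0 i : E i := vsval (v i).
have v_perp i : v0 i \in Eperp w i by exact: subvsP.
have [lam rec] := int_recurrence (drift w v0).
pose u := lift_by w v0 lam.
have Iu : forall a i, first_integral w a (u i) (u (i + 1)) = 0.
  exact/(first_integral_lift G_nondeg G_sym lam v_perp).
have u_lifts : lifts u.
  split; [|exact: Iu|by move=> i; apply: Pi_add_lincomb].
  apply: (trajectory_of_perp w_trajectory) => // i h h_perp.
  rewrite (EL_lift w_trajectory rec h_perp).
  by have /perp_trajectoryP-> := v_traj; rewrite ?subrr.
exists u; split; [exact: u_lifts|move=> u'].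
have [u_traj _ Piu] := u_lifts.
rewrite (GammaP w_trajectory w_basis _ P_poincare V_fixed).
rewrite -(trivial_reduction w_trajectory G_nondeg G_sym).
split=> [[u'_traj Iu' Piu']|[d_traj Id Pid]]; split.
- exact: ltrajectoryB.
- by move=> a i; rewrite first_integralB Iu' Iu subrr.
- by move=> i; rewrite PiB Piu' Piu subrr.
- apply/ltrajectoryP => i h.
  have /ltrajectoryP/(_ i h) := d_traj; rewrite ELB.
  by have /ltrajectoryP-> := u_traj; rewrite subr0.
- move=> a i; have := Id a i; rewrite first_integralB Iu subr0; exact.
- by move=> i; have /eqP := Pid i; rewrite PiB Piu subr_eq0 => /eqP.
Qed.
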